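(* Let $(g,J,\Omega)$ be a pseudo-Kähler or para-Kähler structure on $M$ with $J_i{}^pJ_p{}^j=\epsilon\delta_i{}^j$ and let $\mathscr{K}$ denote the symplectic curvature quadratic forms of the Levi-Civita connection of $g$. Let $p\in M$, let $X\in T_pM$ be nonnull (i.e. $g(X,X)\neq 0$), and let $L$ be the span of $X$ and $JX$. Then the symplectic sectional curvature of $L$ equals the (para-)holomorphic sectional curvature $\mathscr{H}_{p,L}$ of $L$ multiplied by the restriction to $L$ of $g$. Precisely, $$\mathscr{K}_{p,L}(Y)=g(Y,Y)\,\mathscr{H}_{p,L}$$ for all $Y$ contained in $L$.
   Context: A pseudo-Kähler (resp. para-Kähler) structure $(g,J,\Omega)$ on a smooth connected manifold $M$ consists of a symplectic form $\Omega_{ij}$, an integrable field of endomorphisms $J_i{}^j$ of $TM$ with $J_p{}^jJ_i{}^p=\epsilon\delta_i{}^j$, where $\epsilon=-1$ (resp. $\epsilon=1$), and a pseudo-Riemannian metric $g_{ij}$ (of split signature in the para-Kähler case) with $J_i{}^pg_{pj}=\Omega_{ij}$, i.e. $\Omega(X,Y)=g(JX,Y)$. The Levi-Civita connection $D$ of $g$ satisfies $D\Omega=0$. Its curvature is $R(X,Y)Z=D_XD_YZ-D_YD_XZ-D_{[X,Y]}Z$. A two-dimensional subspace $L\subset T_pM$ is symplectic if $\Omega|_L$ is nondegenerate. For such $L$ the symplectic curvature quadratic form is $\mathscr{K}_{p,L}(Z)=\Omega(R(X,Y)Z,Z)/\Omega(X,Y)$ for any basis $X,Y$ of $L$ (independent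 of the choice); the symplectic sectional curvature of $L$ is the restriction of $\mathscr{K}_{p,L}$ to $L$. For $X\in T_pM$ with $g(X,X)\ne0$ and $L=\mathrm{span}\{X,JX\}$ (which is symplectic), the (para-)holomorphic sectional curvature of $L$ is $$\mathscr{H}_{p,L}=\frac{g(R(JX,X)X,JX)}{g(X,X)g(JX,JX)-g(X,JX)^2}.$$ *)

(* Defs.v *)
From HB Require Import structures.
From mathcomp Require Import all_boot all_order all_algebra.
From mathcomp Require Import all_classical all_reals all_analysis.

Set Implicit Arguments.
Unset Strict Implicit.
Unset Printing Implicit Defensive.

Import Order.TTheory GRing.Theory Num.Theory.
Import numFieldNormedType.Exports.

Local Open Scope classical_set_scope.
Local Open Scope ring_scope.

(* C^k and C^oo maps on an open set U of a normed space.  In finite dimension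
   the directional derivatives being C^k is the same as the differential
   being C^k. *)
Fixpoint Ck (R : realType) (V W : normedModType R) (k : nat) (U : set V)
    (f : V -> W) : Prop :=
  match k with
  | 0 => forall x, U x -> {for x, continuous f}
  | k'.+1 => (forall x, U x -> differentiable f x) /\
             (forall v : V, Ck k' U (fun x => 'D_v f x))
  end.

Definition smooth_on (R : realType) (V W : normedModType R) (U : set V)
  (f : V -> W) : Prop := forall k, Ck k U f.

(* [coord] and [param] are total functions; they are mutually inverse
   homeomorphisms between the open sets [dom] and [coord @` dom], and carry
   no information elsewhere. *)
Record chart (R : realType) (n : nat) (M : topologicalType) := Chart {
  dom : set M;
  coord : M -> 'rV[R]_n;
  param : 'rV[R]_n -> M;
  dom_open : open dom;
  codom_open : open (coord @` dom);
  coordK : forall q, dom q -> param (coord q) = q;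
  coord_continuous : forall q, dom q -> {for q, continuous coord};
  param_continuous : forall q, dom q -> {for coord q, continuous param}
}.

(* Connected smooth manifolds of dimension n, with a distinguished chart
   [chart_at p] around each point p. *)
Record smoothManifold (R : realType) (n : nat) := SmoothManifold {
  carrier :> topologicalType;
  carrier_hausdorff : hausdorff_space carrier;
  carrier_second_countable : @second_countable carrier;
  carrier_connected : connected [set: carrier];
  atlas : set (chart R n carrier);
  chart_at : carrier -> chart R n carrier;
  chart_at_atlas : forall p, atlas (chart_at p);
  chart_at_dom : forall p, dom (chart_at p) p;
  atlas_smooth : forall c d, atlas c -> atlas d ->
    smooth_on (coord c @` (dom c `&` dom d)) (coord d \o param c)
}.

Section Geometry.
Context {R : realType} {n : nat} {M : smoothManifold R n}.

(* A tangent vector at p is represented by its components in [chart_at p]. *)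
Definition tangent (p : M) : vectType R := 'rV[R]_n.

Definition vector_field := forall p : M, tangent p.

(* Components in the chart c of a tangent vector at q. *)
Definition components (c : chart R n M) (q : M) (v : tangent q) : 'rV[R]_n :=
  'D_v (coord c \o param (chart_at q)) (coord (chart_at q) q).

Definition field_in_chart (c : chart R n M) (X : vector_field) :
    'rV[R]_n -> 'rV[R]_n :=
  fun x => components c (X (param c x)).

(* v f, for a tangent vector v at p *)
Definition dird (f : M -> R) (p : M) (v : tangent p) : R :=
  'D_v ((f : M -> R^o) \o param (chart_at p)) (coord (chart_at p) p).

(* Smoothness on some neighbourhood of p.  Functions and vector fields are
   total, so that a local one defined around p is represented by an arbitrary
   extension. *)
Definition smooth_fun_near (f : M -> R) (p : M) : Prop :=
  exists2 U : set M, open_nbhs p U &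
    forall c, @atlas R n M c ->
      smooth_on (coord c @` (dom c `&` U)) ((f : M -> R^o) \o param c).

Definition smooth_field_near (X : vector_field) (p : M) : Prop :=
  exists2 U : set M, open_nbhs p U &
    forall c, @atlas R n M c ->
      smooth_on (coord c @` (dom c `&` U)) (field_in_chart c X).

(* [X, Y]^i = X^j d_j Y^i - Y^j d_j X^i, computed at p in [chart_at p] *)
Definition lie_bracket (X Y : vector_field) : vector_field := fun p =>
  let c := chart_at p in
  'D_(X p) (field_in_chart c Y) (coord c p)
  - 'D_(Y p) (field_in_chart c X) (coord c p).

(* The vector field around p with constant components v in [chart_at p]. *)
Definition constant_extension (p : M) (v : tangent p) : vector_field :=
  fun q => 'D_v (coord (chart_at q) \o param (chart_at p))
                (coord (chart_at p) q).

(* Covariant tensors b_ij and endomorphisms J_i^j are fields of matrices: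
   b(u, v) = u^i b_ij v^j and (J u)^j = u^i J_i^j, in [chart_at p] at p.
   Thus J_i^p g_pj is the matrix product J *m g. *)
Definition bform (b : M -> 'M[R]_n) (p : M) (u v : tangent p) : R :=
  (u *m b p *m v^T) 0 0.

Definition endo (J : M -> 'M[R]_n) (p : M) (u : tangent p) : tangent p :=
  u *m J p.

Definition endo_field (J : M -> 'M[R]_n) (X : vector_field) : vector_field :=
  fun p => endo J (X p).

Definition smooth_form (b : M -> 'M[R]_n) : Prop :=
  forall (p : M) (X Y : vector_field),
    smooth_field_near X p -> smooth_field_near Y p ->
    smooth_fun_near (fun q => bform b (X q) (Y q)) p.

Definition smooth_endo (J : M -> 'M[R]_n) : Prop :=
  forall (p : M) (X : vector_field),
    smooth_field_near X p -> smooth_field_near (endo_field J X) p.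

Record pseudo_riemannian (g : M -> 'M[R]_n) : Prop := {
  metric_smooth : smooth_form g;
  metric_sym : forall p, (g p)^T = g p;
  metric_nondegenerate : forall p, g p \in unitmx
}.

Definition closed_form (Om : M -> 'M[R]_n) : Prop :=
  forall (p : M) (X Y Z : vector_field),
    smooth_field_near X p -> smooth_field_near Y p -> smooth_field_near Z p ->
    dird (fun q => bform Om (Y q) (Z q)) (X p)
    + dird (fun q => bform Om (Z q) (X q)) (Y p)
    + dird (fun q => bform Om (X q) (Y q)) (Z p)
    - bform Om (lie_bracket X Y p) (Z p)
    - bform Om (lie_bracket Y Z p) (X p)
    - bform Om (lie_bracket Z X p) (Y p) = 0.

Record symplectic_form (Om : M -> 'M[R]_n) : Prop := {
  symplectic_smooth : smooth_form Om;
  symplectic_antisym : forall p, (Om p)^T = - Om p;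
  symplectic_nondegenerate : forall p, Om p \in unitmx;
  symplectic_closed : closed_form Om
}.

(* vanishing of the Nijenhuis tensor of J *)
Definition integrable_endo (J : M -> 'M[R]_n) : Prop :=
  forall (p : M) (X Y : vector_field),
    smooth_field_near X p -> smooth_field_near Y p ->
    lie_bracket (endo_field J X) (endo_field J Y) p
    - endo J (lie_bracket (endo_field J X) Y p)
    - endo J (lie_bracket X (endo_field J Y) p)
    + endo J (endo J (lie_bracket X Y p)) = 0.

Definition split_signature (G : 'M[R]_n) : Prop :=
  exists m : nat, n = m.*2 /\
    exists2 P : 'M[R]_n, P \in unitmx &
      P *m G *m P^T = diag_mx (\row_(i < n) (if (i < m)%N then 1 else -1)).

Record kahler_structure (eps : R) (g J Om : M -> 'M[R]_n) : Prop := {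
  kahler_metric : pseudo_riemannian g;
  kahler_symplectic : symplectic_form Om;
  kahler_endo_smooth : smooth_endo J;
  kahler_endo_sqr : forall p, J p *m J p = eps%:M;
  kahler_endo_integrable : integrable_endo J;
  kahler_compatible : forall p, J p *m g p = Om p
}.

Definition pseudo_kahler (g J Om : M -> 'M[R]_n) : Prop :=
  kahler_structure (-1) g J Om.

Definition para_kahler (g J Om : M -> 'M[R]_n) : Prop :=
  kahler_structure 1 g J Om /\ (forall p, split_signature (g p)).

(* Affine connections, as operators on local vector fields; [nabla Y v] is
   D_v Y at the base point of v.  Nothing is required of [nabla Y] at points
   near which Y is not smooth.  Locality follows from the Leibniz rule applied
   to the indicator function of a neighbourhood of p. *)
Record connection := Connection {
  nabla :> vector_field -> forall p : M, tangent p -> tangent p;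
  nabla_linear : forall (p : M) (Y : vector_field), smooth_field_near Y p ->
    forall (a : R) (u v : tangent p),
      nabla Y (a *: u + v) = a *: nabla Y u + nabla Y v;
  nabla_add : forall (p : M) (Y Z : vector_field) (v : tangent p),
    smooth_field_near Y p -> smooth_field_near Z p ->
    nabla (fun q => Y q + Z q) v = nabla Y v + nabla Z v;
  nabla_leibniz : forall (p : M) (f : M -> R) (Y : vector_field)
      (v : tangent p),
    smooth_fun_near f p -> smooth_field_near Y p ->
    nabla (fun q => f q *: Y q) v = dird f v *: Y p + f p *: nabla Y v;
  nabla_smooth : forall (p : M) (X Y : vector_field),
    smooth_field_near X p -> smooth_field_near Y p ->
    smooth_field_near (fun q => nabla Y (X q)) p
}.

Record levi_civita (g : M -> 'M[R]_n) (D : connection) : Prop := {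
  torsion_free : forall (p : M) (X Y : vector_field),
    smooth_field_near X p -> smooth_field_near Y p ->
    D Y p (X p) - D X p (Y p) = lie_bracket X Y p;
  metric_parallel : forall (p : M) (Y Z : vector_field) (v : tangent p),
    smooth_field_near Y p -> smooth_field_near Z p ->
    dird (fun q => bform g (Y q) (Z q)) v
    = bform g (D Y p v) (Z p) + bform g (Y p) (D Z p v)
}.

Definition curvature_field (D : connection) (X Y Z : vector_field) :
    vector_field := fun p =>
  D (fun q => D Z q (Y q)) p (X p) - D (fun q => D Z q (X q)) p (Y p)
  - D Z p (lie_bracket X Y p).

(* The curvature being tensorial, any smooth extensions of x, y, z to a
   neighbourhood of p give the same value. *)
Definition curvature (D : connection) (p : M) (x y z : tangent p) : tangent p :=
  curvature_field D (constant_extension x) (constant_extension y)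
    (constant_extension z) p.

(* Meaningful for a symplectic plane L, where any basis of L gives the same
   value as the basis [vbasis L]. *)
Definition symplectic_curvature (Om : M -> 'M[R]_n) (D : connection) (p : M)
    (L : {vspace tangent p}) (Z : tangent p) : R :=
  let A := (vbasis L)`_0 in
  let B := (vbasis L)`_1 in
  bform Om (curvature D A B Z) Z / bform Om A B.

(* The curvature of the plane spanned by X and JX, for X nonnull. *)
Definition holomorphic_curvature (g J : M -> 'M[R]_n) (D : connection) (p : M)
    (X : tangent p) : R :=
  let JX := endo J X in
  bform g (curvature D JX X X) JX
  / (bform g X X * bform g JX JX - bform g X JX ^+ 2).

End Geometry.

Arguments tangent {R n M} p.
Arguments connection {R n} M.

(* Main.v *)
Require Import Defs.
From HB Require Import structures.
From mathcomp Require Import all_boot all_order all_algebra.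
From mathcomp Require Import all_classical all_reals all_analysis.
From mathcomp Require Import ring lra.

Set Implicit Arguments.
Unset Strict Implicit.
Unset Printing Implicit Defensive.

Import Order.TTheory GRing.Theory Num.Theory.
Import numFieldNormedType.Exports.

Local Open Scope classical_set_scope.
Local Open Scope ring_scope.

(** Write R for the curvature of D and C = R(X, JX).  On the plane L spanned by
    X and JX everything follows from three symmetries of R at p:
    - R(x, y) is bilinear and alternating in x, y ([curvature_linear1],
      [curvature_antisym]);
    - R(x, y) is linear and skew for g ([curvature_linear3],
      [curvature_skew]);
    - R(x, y) commutes with J ([curvature_endo]).

    By the first, R(A, B) / Om(A, B) does not depend on the basis A, B of L, so
    the basis X, JX may be used.  By the other two, g(CX, X) = 0, and
    Om(CY, Y) = g(JCY, Y) is, for Y = a X + b JX, equal to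
    (eps b^2 - a^2) g(CX, JX), while g(Y, Y) = (a^2 - eps b^2) g(X, X) because
    g(X, JX) = 0 and g(JX, JX) = - eps g(X, X).  The two quadratic forms are
    proportional, and comparing the factors is a computation in a field.

    Skewness of R(x, y) is the symmetry of second derivatives
    ([derive_sym]) applied to the function g(Z, W) and to the coordinate
    fields extending x and y, whose bracket vanishes at p.  It holds for all
    fields Z and W near p; hence, g being nondegenerate, R(x, y)Z at p is
    determined by the value of Z at p and depends linearly on it, with no
    computation in a frame ([curvature_tensorial]).

    That R(x, y) commutes with J comes from DJ = 0 ([nabla_endo0]).  With
    T(X, Y, Z) = g((D_X J)Y, Z), the closedness of Om says that the cyclic sum
    of T vanishes, the vanishing of the Nijenhuis tensor says that
    A(X, Y, Z) = T(JX, Y, Z) + T(X, Y, JZ) is symmetric in X, Y, and both T and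
    A are skew in Y, Z.  A trilinear form symmetric in one pair of
    neighbouring arguments and skew in the other is zero, so A = 0; two
    instances of the cyclic identity then give 2 T(Z, X, JY) = 0.

    The rest is calculus in charts: composites of smooth maps are smooth
    ([Ck_comp]), so that the coordinate fields are smooth
    ([constant_extension_smooth]), and a connection depends only on the germ
    of a field ([nabla_local]). *)

(** * Calculus on open sets of normed spaces *)

Lemma differentiable_near_eq (R : realType) (V W : normedModType R)
    (f g : V -> W) (x : V) :
  (\near x, f x = g x) -> differentiable f x -> differentiable g x.
Proof.
move=> fg df; have [dc /eqaddoP fo] := (diff_locallyP _ _).1 df.
have gx := nbhs_singleton fg.
have go : g \o shift x = cst (g x) + 'd f x +o_ 0 id.
  apply/eqaddoP => e e0; near=> h.
  have : `|(f \o shift x - (cst (f x) + 'd f x)) h| <= e * `|h|.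
    by near: h; exact: fo.
  rewrite !fctE /= gx; suff -> : f (h + x) = g (h + x) by [].
  near: h; move: fg; rewrite (near_shift 0 x) /=.
  by apply: filterS => h /=; rewrite subr0.
have gE : 'd g x = 'd f x :> (V -> W) by exact: diff_unique.
by apply/diff_locallyP; rewrite gE.
Unshelve. all: by end_near. Qed.

Lemma scale_is_bilinear (R : realType) (W : normedModType R) :
  bilinear_for
    (GRing.Scale.Law.clone _ _ *:%R _) (GRing.Scale.Law.clone _ _ *:%R _)
    (fun (k : R^o) (w : W) => k *: w).
Proof.
split=> [u'|u] a x y /=; first by rewrite scalerDl scalerA.
by rewrite scalerDr !scalerA mulrC.
Qed.

Section ProductRule.
Context (R : realType) (V W : normedModType R).
Variables (k : V -> R^o) (f : V -> W) (x : V).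
Hypotheses (dk : differentiable k x) (df : differentiable f x).

(* The product is differentiated as a continuous bilinear map. *)
Let S : {bilinear R^o -> W -> W} :=
  let m := bilinear_isBilinear.Build R R^o W W _ _ _ (@scale_is_bilinear R W) in
  HB.pack (fun (k : R^o) (w : W) => k *: w) m.

Lemma differentiable_scale : differentiable (fun y => k y *: f y) x.
Proof.
have Sd p : differentiable (fun p : R^o * W => S p.1 p.2) p.
  by apply: differentiable_bilin => q; exact: scale_continuous.
have := differentiable_comp (differentiable_pair dk df) (Sd (k x, f x)).
exact.
Qed.

Lemma derive_scale v :
  'D_v (fun y => k y *: f y) x = 'D_v k x *: f x + k x *: 'D_v f x.
Proof.
have Sc : continuous (fun p : R^o * W => S p.1 p.2).
  by move=> q; exact: scale_continuous.
have Sd p : differentiable (fun p : R^o * W => S p.1 p.2) p.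
  exact: differentiable_bilin.
rewrite deriveE; last exact: differentiable_scale.
have := diff_comp (differentiable_pair dk df) (Sd (k x, f x)).
rewrite diff_pair // diff_bilin //= => /(congr1 (fun h => h v)) /=.
rewrite addrC => e.
rewrite -[LHS]/('d ((fun p : R^o * W => S p.1 p.2)
                     \o (fun y => (k y, f y))) x v) e.
by rewrite !deriveE.
Qed.
End ProductRule.

Lemma derive_comp (R : realType) (U V W : normedModType R) (h : U -> V)
    (f : V -> W) (x v : U) :
  differentiable h x -> differentiable f (h x) ->
  'D_v (f \o h) x = 'D_('D_v h x) f (h x).
Proof.
move=> dh df; rewrite !deriveE //; last exact: differentiable_comp.
by rewrite diff_comp.
Qed.

Lemma derive_coord (R : realType) (V : normedModType R) n (f : V -> 'rV[R]_n)
    (x v : V) (i : 'I_n) :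
  differentiable f x -> 'D_v (fun y => f y 0 i : R^o) x = 'D_v f x 0 i.
Proof.
by move=> df; rewrite derive_mx; [rewrite mxE | exact: diff_derivable].
Qed.

Section Ck.
Context {R : realType}.

Lemma Ck_subset (V W : normedModType R) k (A B : set V) (f : V -> W) :
  A `<=` B -> Ck k B f -> Ck k A f.
Proof.
move=> AB; elim: k f => [|k IH] f /=; first by move=> fB x /AB; exact: fB.
by move=> [df Df]; split=> [x /AB|v]; [exact: df | exact: IH].
Qed.

Lemma Ck_eq (V W : normedModType R) k (A : set V) (f g : V -> W) :
  open A -> {in A, f =1 g} -> Ck k A f -> Ck k A g.
Proof.
move=> oA; elim: k f g => [|k IH] f g fg /=.
  move=> fc x Ax; have fcx := fc x Ax.
  have gx : f x = g x by apply: fg; rewrite inE.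
  suff : g @ x --> f x by rewrite gx.
  apply: cvg_trans fcx; apply: near_eq_cvg.
  by near=> y; apply: fg; rewrite inE; near: y; exact: open_nbhs_nbhs.
have near_fg x : A x -> \near x, f x = g x.
  move=> Ax; near=> y; apply: fg; rewrite inE; near: y.
  exact: open_nbhs_nbhs.
move=> [df Df]; split=> [x Ax|v].
  by apply: differentiable_near_eq (df x Ax); exact: near_fg.
apply: IH (Df v) => x; rewrite inE => Ax; exact: near_eq_derive (near_fg x Ax).
Unshelve. all: by end_near. Qed.

Lemma CkW (V W : normedModType R) k (A : set V) (f : V -> W) :
  Ck k.+1 A f -> Ck k A f.
Proof.
elim: k f => [|k IH] f [df Df]; first by move=> x /df/differentiable_continuous.
by split=> // v; exact/IH/Df.
Qed.

Lemma Ck_cst (V W : normedModType R) k (A : set V) (w : W) :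
  Ck k A (fun _ : V => w).
Proof.
elim: k w => [|k IH] w /=; first by move=> x _; exact: cst_continuous.
split=> [x _|v]; first exact: differentiable_cst.
have -> : (fun x : V => 'D_v (fun=> w) x) = fun=> 0.
  by apply/funext => x; rewrite (derive_cst w).
exact: IH.
Qed.

Lemma Ck_add (V W : normedModType R) k (A : set V) (f g : V -> W) :
  open A -> Ck k A f -> Ck k A g -> Ck k A (fun x => f x + g x).
Proof.
move=> oA; elim: k f g => [|k IH] f g /=.
  by move=> fc gc x Ax; apply: continuousD; [exact: fc | exact: gc].
move=> [df Df] [dg Dg]; split=> [x Ax|v].
  by apply: differentiableD; [exact: df | exact: dg].
apply: (Ck_eq oA _ (IH _ _ (Df v) (Dg v))) => x; rewrite inE => Ax.
rewrite -deriveD //; apply: diff_derivable; [exact: df | exact: dg].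
Qed.

Lemma Ck_sum (V W : normedModType R) k (A : set V) n (f : 'I_n -> V -> W) :
  open A -> (forall i, Ck k A (f i)) -> Ck k A (fun x => \sum_i f i x).
Proof.
move=> oA; elim: n f => [|n IH] f cf.
  rewrite (_ : (fun x => _) = fun=> 0); first exact: Ck_cst.
  by apply/funext => x; rewrite big_ord0.
rewrite (_ : (fun x => _) = fun x => f ord0 x + \sum_i f (lift ord0 i) x).
  by apply: Ck_add => //; exact: IH.
by apply/funext => x; rewrite big_ord_recl.
Qed.

Lemma Ck_scale (V W : normedModType R) k (A : set V) (f : V -> R^o)
    (g : V -> W) :
  open A -> Ck k A f -> Ck k A g -> Ck k A (fun x => f x *: g x).
Proof.
move=> oA; elim: k f g => [|k IH] f g.
  move=> fc gc x Ax; apply: cvgZ; [exact: fc | exact: gc].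
move=> cf cg; have [df Df] := cf; have [dg Dg] := cg; split=> [x Ax|v].
  by apply: differentiable_scale; [exact: df | exact: dg].
have fgk : Ck k A (fun x => 'D_v f x *: g x + f x *: 'D_v g x).
  apply: Ck_add oA (IH _ _ (Df v) (CkW cg)) (IH _ _ (CkW cf) (Dg v)).
apply: (Ck_eq oA _ fgk) => x; rewrite inE => Ax.
by rewrite derive_scale //; [exact: df | exact: dg].
Qed.

Lemma Ck_coord (V : normedModType R) n k (A : set V) (f : V -> 'rV[R]_n)
    (i : 'I_n) :
  open A -> Ck k A f -> Ck k A (fun x => f x 0 i : R^o).
Proof.
move=> oA; elim: k f => [|k IH] f /=.
  move=> fc x Ax.
  by apply: (@continuous_comp _ _ _ f (fun u : 'rV[R]_n => u 0 i : R^o));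
    [exact: fc | exact: coord_continuous].
move=> [df Df]; split=> [x Ax|v].
  by apply: (@differentiable_comp _ _ _ _ f (fun u : 'rV[R]_n => u 0 i : R^o));
    [exact: df | exact: differentiable_coord].
apply: (Ck_eq oA _ (IH _ (Df v))) => x; rewrite inE => Ax.
by rewrite derive_coord //; exact: df.
Qed.

(** Each partial derivative of f \o h is a sum of products of components of
    'D_v h with composites 'D_(e_i) f \o h, all of class C^k by induction when f
    and h are of class C^(k+1); this is why the middle space has a basis. *)
Lemma Ck_comp (V W : normedModType R) n k (A : set V) (B : set 'rV[R]_n)
    (h : V -> 'rV[R]_n) (f : 'rV[R]_n -> W) :
  open A -> (forall x, A x -> B (h x)) ->
  Ck k A h -> Ck k B f -> Ck k A (f \o h).
Proof.
move=> oA AB; elim: k f => [|k IH] f.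
  move=> hc fc x Ax.
  by apply: continuous_comp; [exact: hc | exact: fc (AB _ Ax)].
move=> ch cf; have [dh Dh] := ch; have [df Df] := cf; split=> [x Ax|v].
  by apply: differentiable_comp; [exact: dh | exact: df (AB _ Ax)].
have ck : Ck k A (fun x => \sum_i 'D_v h x 0 i *: ('D_(delta_mx 0 i) f \o h) x).
  apply: Ck_sum => // i.
  exact: Ck_scale oA (Ck_coord i oA (Dh v)) (IH _ (CkW ch) (Df _)).
apply: (Ck_eq oA _ ck) => x; rewrite inE => Ax.
have dhx := dh x Ax; have dfx := df _ (AB _ Ax).
rewrite (derive_comp v dhx dfx) [RHS](deriveE _ dfx).
rewrite [in RHS](row_sum_delta ('D_v h x)) linear_sum; apply: eq_bigr => i _.
by rewrite linearZ /= (deriveE _ dfx).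
Qed.

End Ck.

(** * Symmetry of second derivatives *)

Section Schwarz.
Context {R : realType} {V : normedModType R}.
Implicit Types (F : V -> R^o) (A : set V) (v w x : V).

Lemma is_derive_line F x v (s : R) :
  differentiable F (x + s *: v) ->
  is_derive s 1 (fun r : R => F (x + r *: v)) ('D_v F (x + s *: v)).
Proof.
move=> dF; have dl : differentiable (fun r : R^o => x + r *: v) s.
  by apply: differentiableD => //; exact: differentiableZl.
have dlE : 'D_1 (fun r : R^o => x + r *: v) s = v.
  have -> : (fun r : R^o => x + r *: v) = cst x + ( *:%R ^~ v) by [].
  by rewrite deriveE // diffD // diff_cst diff_val /= add0r scale1r.
have -> : (fun r : R => F (x + r *: v)) = F \o (fun r : R^o => x + r *: v).
  by [].
apply: DeriveDef; first exact/diff_derivable/differentiable_comp.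
by rewrite derive_comp // dlE.
Qed.

(** The second difference is the increment over [0, t] of
    r |-> F (x + t w + r v) - F (x + r v); the mean value theorem in r turns it
    into an increment of 'D_v F along w, and the mean value theorem in s into a
    second derivative. *)
Lemma second_difference_mvt F A x v w (t : R) :
  Ck 2 A F -> 0 < t ->
  (forall r s, 0 <= r <= t -> 0 <= s <= t -> A (x + r *: v + s *: w)) ->
  exists r s, [/\ 0 <= r <= t, 0 <= s <= t &
    F (x + t *: v + t *: w) - F (x + t *: v) - F (x + t *: w) + F x
    = 'D_w ('D_v F) (x + r *: v + s *: w) * t ^+ 2].
Proof.
move=> [dF DF] t0 inA; have [dDF _] := DF v.
have t00 : 0 <= t <= t by rewrite ltW /=.
have z0t : (0 : R) <= 0 <= t by rewrite lexx ltW.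
have inA0 r : 0 <= r <= t -> A (x + r *: v).
  by move=> rt; have := inA r 0 rt z0t; rewrite scale0r addr0.
have inAt r : 0 <= r <= t -> A (x + t *: w + r *: v).
  by move=> rt; rewrite addrAC; exact: inA.
pose phi (r : R) : R := F (x + t *: w + r *: v) - F (x + r *: v).
pose dphi (r : R) : R := 'D_v F (x + t *: w + r *: v) - 'D_v F (x + r *: v).
have phi_der r : r \in `[0, t] -> is_derive r 1 phi (dphi r).
  by rewrite in_itv => /= rt; apply: is_deriveB; apply: is_derive_line;
    apply: dF; [exact: inAt | exact: inA0].
have cont (h dh : R -> R) :
    (forall r, r \in `[0, t] -> is_derive r 1 h (dh r)) ->
    {within `[0, t], continuous h}.
  by move=> hd; apply: derivable_within_continuous => r rt; have [] := hd r rt.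
have oc r : r \in `]0, t[ -> r \in `[0, t] by exact: subset_itv_oo_cc.
have [r /oc r0t phiE] :=
  MVT t0 (fun r rt => phi_der r (oc r rt)) (cont _ _ phi_der).
pose psi (s : R) : R := 'D_v F (x + r *: v + s *: w).
have rt : 0 <= r <= t by move: r0t; rewrite in_itv.
have psi_der s : s \in `[0, t] ->
    is_derive s 1 psi ('D_w ('D_v F) (x + r *: v + s *: w)).
  by rewrite in_itv /= => st; apply: is_derive_line; apply: dDF; exact: inA.
have [s /oc s0t psiE] :=
  MVT t0 (fun r rt => psi_der r (oc r rt)) (cont _ _ psi_der).
have st : 0 <= s <= t by move: s0t; rewrite in_itv.
exists r, s; split => //.
have dphiE : dphi r = psi t - psi 0.
  by rewrite /dphi /psi scale0r addr0 (addrAC x).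
move: phiE; rewrite dphiE psiE /phi scale0r !addr0 subr0 (addrAC x) => e.
by rewrite expr2 mulrA -e opprB addrA addrAC.
Qed.

(** The second difference of F is symmetric in v and w, so the two second
    derivatives take a common value at two points arbitrarily close to x; by
    continuity they agree at x. *)
Lemma derive_sym F A x v w :
  open A -> A x -> Ck 2 A F -> 'D_w ('D_v F) x = 'D_v ('D_w F) x.
Proof.
move=> oA Ax cF; apply/eqP; rewrite -subr_eq0 -normr_le0.
apply/ler_addgt0Pr => e e0.
rewrite add0r.
have cvw := (cF.2 v).2 w x Ax; have cwv := (cF.2 w).2 v x Ax.
have e20 : 0 < e / 2 by rewrite divr_gt0.
have nA : nbhs x A by exact: open_nbhs_nbhs.
have /cvgrPdist_lt/(_ _ e20) nvw := cvw.
have /cvgrPdist_lt/(_ _ e20) nwv := cwv.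
have [d /= d0 dP] := (nbhs_ballP _ _).1 (filterI nA (filterI nvw nwv)).
(* The parallelogram spanned at x by t v and t w lies in the ball of
   radius d. *)
pose m := 1 + `|v| + `|w|.
have m0 : 0 < m by rewrite /m -addrA ltr_pwDl // addr_ge0.
pose t := d / (2 * m).
have t0 : 0 < t by rewrite divr_gt0 // mulr_gt0.
have small r s : 0 <= r <= t -> 0 <= s <= t -> ball x d (x + r *: v + s *: w).
  move=> /andP[r0 rt] /andP[s0 st].
  rewrite -ball_normE /= -addrA opprD addNKr normrN.
  apply: le_lt_trans (ler_normD _ _) _; rewrite !normrZ !ger0_norm //.
  have : r * `|v| + s * `|w| <= t * m.
    have := ler_wpM2r (normr_ge0 v) rt; have := ler_wpM2r (normr_ge0 w) st.
    rewrite /m; lra.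
  move=> /le_lt_trans; apply; rewrite /t invfM mulrA mulfVK ?gt_eqF //.
  by rewrite ltr_pdivrMr // mulr_natr mulr2n ltrDl.
have inA r s : 0 <= r <= t -> 0 <= s <= t -> A (x + r *: v + s *: w).
  by move=> rt st; have [] := dP _ (small r s rt st).
have [r [s [rt st E1]]] := second_difference_mvt cF t0 inA.
have [r' [s' [rt' st' E2]]] : exists r s, [/\ 0 <= r <= t, 0 <= s <= t &
    F (x + t *: w + t *: v) - F (x + t *: w) - F (x + t *: v) + F x
    = 'D_v ('D_w F) (x + r *: w + s *: v) * t ^+ 2].
  apply: second_difference_mvt cF t0 _ => r' s' ? ?.
  by rewrite addrAC; exact: inA.
have zE : x + r' *: w + s' *: v = x + s' *: v + r' *: w by rewrite addrAC.
have E : 'D_w ('D_v F) (x + r *: v + s *: w)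
    = 'D_v ('D_w F) (x + s' *: v + r' *: w).
  apply: (mulIf (expf_neq0 2 (lt0r_neq0 t0))); apply: etrans (esym E1) _.
  move: E2; rewrite zE => E2; apply: etrans E2.
  by rewrite (addrAC x (t *: v)); congr (_ + F x); rewrite [LHS]addrAC.
have [_ [/= h1 _]] := dP _ (small r s rt st).
have [_ [_ /= h2]] := dP _ (small s' r' st' rt').
rewrite E in h1; rewrite distrC in h2.
apply: ltW; rewrite [e]splitr; apply: le_lt_trans (ltrD h1 h2).
by apply: le_trans (ler_normD _ _); rewrite addrA subrK.
Qed.
End Schwarz.

Local Notation coord := Defs.coord.

(** * Charts and coordinate fields *)

Section Charts.
Context {R : realType} {n : nat} {M : smoothManifold R n}.
Implicit Types (c d : chart R n M) (p q : M).

Lemma param_near c q (A : set M) :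
  dom c q -> nbhs q A -> \forall x \near coord c q, A (param c x).
Proof. by move=> cq qA; have := param_continuous cq; apply; rewrite coordK. Qed.

Lemma paramK_near c q :
  dom c q -> \forall x \near coord c q, coord c (param c x) = x.
Proof.
move=> cq; have : nbhs (coord c q) (coord c @` dom c).
  by apply: open_nbhs_nbhs; split; [exact: codom_open | exists q].
by apply: filterS => _ [r cr <-]; rewrite coordK.
Qed.

Lemma chart_image_open c (U : set M) :
  open U -> open (coord c @` (dom c `&` U)).
Proof.
move=> oU; rewrite openE => _ [q [cq Uq] <-].
have cUq : nbhs q (dom c `&` U).
  by apply: open_nbhs_nbhs; split => //; apply: openI => //; exact: dom_open.
near=> x; exists (param c x); first by near: x; exact: param_near cq cUq.
by near: x; exact: paramK_near.
Unshelve. all: by end_near. Qed.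

Lemma transition_smooth c d : atlas c -> atlas d ->
  smooth_on (coord c @` (dom c `&` dom d)) (coord d \o param c).
Proof. exact: (@atlas_smooth R n M). Qed.

Lemma transition_differentiable c d q : atlas c -> atlas d ->
  dom c q -> dom d q -> differentiable (coord d \o param c) (coord c q).
Proof.
move=> ac ad cq dq; have [+ _] := transition_smooth ac ad 1.
by apply; exists q.
Qed.

(** The chain rule for F \o param c = (F \o param d) \o (coord d \o param c),
    used both for real functions F and for F = coord c'. *)
Lemma derive_chart_change (W : normedModType R) (F : M -> W) c d q v :
  atlas c -> atlas d -> dom c q -> dom d q ->
  differentiable (F \o param d) (coord d q) ->
  'D_v (F \o param c) (coord c q)
  = 'D_('D_v (coord d \o param c) (coord c q)) (F \o param d) (coord d q).
Proof.
move=> ac ad cq dq dF; have dt := transition_differentiable ac ad cq dq.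
have e : (coord d \o param c) (coord c q) = coord d q by rewrite /= coordK.
rewrite -e in dF *; rewrite -derive_comp //; apply: near_eq_derive.
near=> x; rewrite /= coordK //; near: x; apply: param_near cq _.
by apply: open_nbhs_nbhs; split => //; exact: dom_open.
Unshelve. all: by end_near. Qed.

(** In a chart c the coordinate field is the Jacobian of the transition from
    [chart_at p] to c applied to v; the chart [chart_at q], in which its value
    at q is recorded, cancels out. *)
Lemma components_constant_extension p (v : tangent p) c q :
  atlas c -> dom (chart_at p) q -> dom c q ->
  components c (constant_extension v q)
  = 'D_v (coord c \o param (chart_at p)) (coord (chart_at p) q).
Proof.
move=> ac pq cq.
rewrite /components /constant_extension -derive_chart_change //;
  try exact: chart_at_atlas; try exact: chart_at_dom.
by apply: transition_differentiable => //;
  [exact: chart_at_atlas | exact: chart_at_dom].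
Qed.

Lemma derive_paramK c q v :
  dom c q -> 'D_v (coord c \o param c) (coord c q) = v.
Proof.
move=> cq; rewrite -[RHS](derive_id (coord c q)); apply: near_eq_derive.
exact: paramK_near.
Qed.

Lemma constant_extension_at p (v : tangent p) : constant_extension v p = v.
Proof. exact: derive_paramK (chart_at_dom p). Qed.

Lemma constant_extension_smooth p (v : tangent p) :
  smooth_field_near (constant_extension v) p.
Proof.
have dp := chart_at_dom p; have ap := chart_at_atlas p.
exists (dom (chart_at p)); first by split => //; exact: dom_open.
move=> c ac k.
have o1 : open (coord c @` (dom c `&` dom (chart_at p))).
  exact/chart_image_open/dom_open.
have o2 : open (coord (chart_at p) @` (dom (chart_at p) `&` dom c)).
  exact/chart_image_open/dom_open.
have t1 := transition_smooth ac ap k.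
have [_ /(_ v) t2] := transition_smooth ap ac k.+1.
have im x : (coord c @` (dom c `&` dom (chart_at p))) x ->
    (coord (chart_at p) @` (dom (chart_at p) `&` dom c))
      ((coord (chart_at p) \o param c) x).
  by move=> [q [cq pq] <-] /=; rewrite coordK //; exists q.
apply: Ck_eq o1 _ (Ck_comp o1 im t1 t2) => _ /[1!inE] -[q [cq pq] <-].
by rewrite /field_in_chart /= (coordK cq) components_constant_extension.
Qed.

Lemma constant_extension_linear p (a : R) (u v : tangent p) :
  \forall q \near p, constant_extension (a *: u + v) q
    = a *: constant_extension u q + constant_extension v q.
Proof.
have : nbhs p (dom (chart_at p)).
  by apply: open_nbhs_nbhs; split; [exact: dom_open | exact: chart_at_dom].
apply: filterS => q pq; rewrite /constant_extension.
have dt : differentiable (coord (chart_at q) \o param (chart_at p))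
    (coord (chart_at p) q).
  apply: transition_differentiable => //; try exact: chart_at_atlas.
  exact: chart_at_dom.
by rewrite !(deriveE _ dt) linearP.
Qed.

(** Near p both fields have constant components in [chart_at p]. *)
Lemma lie_bracket_constant_extension p (u v : tangent p) :
  lie_bracket (constant_extension u) (constant_extension v) p = 0.
Proof.
have D0 (w z : tangent p) :
    'D_z (field_in_chart (chart_at p) (constant_extension w))
      (coord (chart_at p) p) = 0.
  rewrite -[RHS](derive_cst (w : 'rV[R]_n) (coord (chart_at p) p) z).
  have dp := chart_at_dom p; apply: near_eq_derive.
  have /(param_near dp) : nbhs p (dom (chart_at p)).
    by apply: open_nbhs_nbhs; split; [exact: dom_open | exact: chart_at_dom].
  apply: filterS => x px; rewrite /field_in_chart.
  rewrite components_constant_extension //; last exact: chart_at_atlas.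
  exact: derive_paramK.
exact: etrans (congr2 (fun x y : 'rV[R]_n => x - y) (D0 v _) (D0 u _))
  (subrr 0).
Qed.

(** * Germs of smooth functions and fields *)

Lemma near_open_nbhs p (P : M -> Prop) :
  (\forall q \near p, P q) -> exists2 V, open_nbhs p V & forall q, V q -> P q.
Proof. by move=> nP; have : nbhs p P by []; rewrite nbhsE. Qed.

Lemma smooth_field_near_eq (X Y : vector_field) p :
  (\forall q \near p, X q = Y q) -> smooth_field_near X p ->
  smooth_field_near Y p.
Proof.
move=> /near_open_nbhs[V [oV Vp] XY] [U [oU Up] sX].
have oUV : open (U `&` V) by exact: openI.
exists (U `&` V); first by split.
move=> c ac k; have oc := chart_image_open (c:=c) oUV.
have sub : coord c @` (dom c `&` (U `&` V)) `<=` coord c @` (dom c `&` U).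
  by apply: image_subset => q [? []].
apply: Ck_eq oc _ (Ck_subset sub (sX c ac k)) => _ /[1!inE] -[q [cq [_ Vq]] <-].
by rewrite /field_in_chart (coordK cq) (XY q Vq).
Qed.

Lemma smooth_field_near_nbhs (X : vector_field) p :
  smooth_field_near X p -> \forall q \near p, smooth_field_near X q.
Proof.
move=> [U Up sX]; have := open_nbhs_nbhs Up; apply: filterS => q Uq.
by exists U; first by split => //; case: Up.
Qed.

Lemma smooth_fun_near_differentiable (f : M -> R) p c :
  atlas c -> dom c p ->
  smooth_fun_near f p -> differentiable ((f : M -> R^o) \o param c) (coord c p).
Proof.
by move=> ac cp [U [_ Up] sf]; have [+ _] := sf c ac 1; apply; exists p.
Qed.

Lemma smooth_fun_near_nbhs (f : M -> R) p :
  smooth_fun_near f p -> \forall q \near p, smooth_fun_near f q.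
Proof.
move=> [U Up sX]; have := open_nbhs_nbhs Up; apply: filterS => q Uq.
by exists U; first by split => //; case: Up.
Qed.

Lemma smooth_fun_near_locally_cst (f : M -> R) p (a : R) :
  (\forall q \near p, f q = a) -> smooth_fun_near f p.
Proof.
move=> /near_open_nbhs[V [oV Vp] fa]; exists V; first by split.
move=> c ac k.
apply: Ck_eq (chart_image_open (c:=c) oV) _ (Ck_cst k _ (a : R^o)).
by move=> _ /[1!inE] -[q [cq Vq] <-] /=; rewrite coordK // fa.
Qed.

Lemma dird_near_eq (f g : M -> R) p (v : tangent p) :
  (\forall q \near p, f q = g q) -> dird f v = dird g v.
Proof.
move=> fg; apply: near_eq_derive.
exact: (param_near (chart_at_dom p) fg).
Qed.

Lemma dird_cst (a : R) p (v : tangent p) : dird (fun=> a) v = 0.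
Proof. exact: (derive_cst (a : R^o)). Qed.

Lemma dird_add (f g : M -> R) p (v : tangent p) :
  smooth_fun_near f p -> smooth_fun_near g p ->
  dird (fun q => f q + g q) v = dird f v + dird g v.
Proof.
move=> sf sg; have ap := chart_at_atlas p; have dp := chart_at_dom p.
have df := smooth_fun_near_differentiable ap dp sf.
have dg := smooth_fun_near_differentiable ap dp sg.
by rewrite /dird -deriveD //; exact: diff_derivable.
Qed.

(** In [chart_at p] the two sides are iterated partial derivatives of f. *)
Lemma dird_constant_extension_sym (f : M -> R) p (u v : tangent p) :
  smooth_fun_near f p ->
  dird (fun q => dird f (constant_extension u q)) v
  = dird (fun q => dird f (constant_extension v q)) u.
Proof.
move=> sf; have ap := chart_at_atlas p; have dp := chart_at_dom p.
have E (x y : tangent p) : dird (fun q => dird f (constant_extension x q)) y =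
    'D_y ('D_x ((f : M -> R^o) \o param (chart_at p))) (coord (chart_at p) p).
  have pd : nbhs p (dom (chart_at p)).
    by apply: open_nbhs_nbhs; split => //; exact: dom_open.
  apply: near_eq_derive; near=> z.
  have zE : coord (chart_at p) (param (chart_at p) z) = z.
    by near: z; exact: paramK_near.
  have zd : dom (chart_at p) (param (chart_at p) z).
    by near: z; exact: param_near.
  have zs : smooth_fun_near f (param (chart_at p) z).
    by near: z; apply: param_near => //; exact: smooth_fun_near_nbhs.
  rewrite -[in RHS]zE /= /dird /constant_extension.
  rewrite -derive_chart_change //;
    try exact: chart_at_atlas; try exact: chart_at_dom.
  by apply: smooth_fun_near_differentiable => //;
    [exact: chart_at_atlas | exact: chart_at_dom].
rewrite [LHS]E [RHS]E.
have [U [oU Up] /(_ _ ap 2) cf] := sf.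
apply: (derive_sym _ _ (chart_image_open oU) _ cf).
exact: ex_intro2 (conj dp Up) erefl.
Unshelve. all: by end_near. Qed.

End Charts.

(** * Connections act on germs of fields *)

Section Connection.
Context {R : realType} {n : nat} {M : smoothManifold R n} (D : connection M).
Implicit Types (p q : M) (X Y Z : vector_field (M := M)).

(** Let f be the indicator function of the set where Y and Z agree.  Then
    f Y = f Z everywhere, and f is locally constant at p with value 1, so the
    Leibniz rule gives D Y v = D (f Y) v = D (f Z) v = D Z v. *)
Lemma nabla_local Y Z p (v : tangent p) :
  (\forall q \near p, Y q = Z q) -> smooth_field_near Y p ->
  D Y p v = D Z p v.
Proof.
move=> YZ sY; have sZ := smooth_field_near_eq YZ sY.
have YZp := nbhs_singleton YZ.
pose f q : R := (`[< Y q = Z q >])%:R.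
have f1 : \forall q \near p, f q = 1.
  by apply: filterS YZ => q e; rewrite /f asboolT.
have sf := smooth_fun_near_locally_cst f1.
have df : dird f v = 0 by rewrite (dird_near_eq _ f1) dird_cst.
have fp : f p = 1 by exact: nbhs_singleton f1.
have := nabla_leibniz D v sf sY; have := nabla_leibniz D v sf sZ.
rewrite df fp !scale0r !add0r !scale1r => <- <-.
congr (nabla D _ _); apply: functional_extensionality_dep => q.
rewrite /f; case: asboolP => [->|_] //; by rewrite !scale0r.
Qed.

Lemma smooth_field_near_scale (a : R) X p :
  smooth_field_near X p -> smooth_field_near (fun q => a *: X q) p.
Proof.
move=> [U [oU Up] sX]; exists U; first by split.
move=> c ac k.
have oc := chart_image_open (c:=c) oU.
apply: Ck_eq oc _ (Ck_scale oc (Ck_cst k _ (a : R^o)) (sX c ac k)).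
move=> _ /[1!inE] -[q [cq Uq] <-]; rewrite /field_in_chart (coordK cq).
have dt := transition_differentiable (chart_at_atlas q) ac (chart_at_dom q) cq.
by rewrite /components (deriveE _ dt) (deriveE _ dt) linearZ.
Qed.

Lemma nablaZ (a : R) Y p (v : tangent p) :
  smooth_field_near Y p -> D (fun q => a *: Y q) p v = a *: D Y p v.
Proof.
move=> sY; have sa : smooth_fun_near (fun _ : M => a) p.
  by apply: (@smooth_fun_near_locally_cst _ _ _ _ _ a); exact: nearW.
by rewrite (nabla_leibniz D v sa sY) dird_cst scale0r add0r.
Qed.

Lemma nabla0 Y p : smooth_field_near Y p -> D Y p 0 = 0.
Proof.
move=> sY; have := nabla_linear D sY (-1) 0 0.
by rewrite scaleN1r addr0 oppr0 scaleN1r addNr.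
Qed.

End Connection.

(** * Bilinear forms and endomorphisms *)

Section Forms.
Context {R : realType} {n : nat} {M : smoothManifold R n}.
Implicit Types (b g J : M -> 'M[R]_n) (p : M).

Lemma bform_linearl b p (a : R) (u v w : tangent p) :
  bform b (a *: u + v) w = a * bform b u w + bform b v w.
Proof. by rewrite /bform -!mulmxA mulmxDl -scalemxAl !mxE. Qed.

Lemma bform_linearr b p (a : R) (u v w : tangent p) :
  bform b w (a *: u + v) = a * bform b w u + bform b w v.
Proof. by rewrite /bform linearP /= mulmxDr -scalemxAr !mxE. Qed.

Lemma bformDl b p (u v w : tangent p) :
  bform b (u + v) w = bform b u w + bform b v w.
Proof. by rewrite -[u in LHS]scale1r bform_linearl mul1r. Qed.

Lemma bformBl b p (u v w : tangent p) :
  bform b (u - v) w = bform b u w - bform b v w.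
Proof. by rewrite addrC -scaleN1r bform_linearl mulN1r addrC. Qed.

Lemma bformBr b p (u v w : tangent p) :
  bform b w (u - v) = bform b w u - bform b w v.
Proof. by rewrite addrC -scaleN1r bform_linearr mulN1r addrC. Qed.

Lemma bform0l b p (w : tangent p) : bform b 0 w = 0.
Proof. by rewrite -(subrr (0 : tangent p)) bformBl subrr. Qed.

Lemma bformZl b p a (u w : tangent p) : bform b (a *: u) w = a * bform b u w.
Proof. by rewrite -[a *: u]addr0 bform_linearl bform0l addr0. Qed.

Lemma bform_tr b p (u v : tangent p) :
  bform b u v = bform (fun q => (b q)^T) v u.
Proof.
have -> : bform b u v = (u *m b p *m v^T)^T 0 0 by rewrite mxE.
by rewrite !trmx_mul trmxK mulmxA.
Qed.

Lemma bformZr b p a (u w : tangent p) : bform b w (a *: u) = a * bform b w u.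
Proof. by rewrite bform_tr bformZl -bform_tr. Qed.

Lemma bformNl b p (u w : tangent p) : bform b (- u) w = - bform b u w.
Proof. by rewrite -scaleN1r bformZl mulN1r. Qed.

Lemma bform_inj g p (u v : tangent p) :
  g p \in unitmx -> (forall w : tangent p, bform g u w = bform g v w) -> u = v.
Proof.
move=> gu uv; have /(congr1 (mulmxr (invmx (g p)))) : u *m g p = v *m g p.
  apply/rowP => i; have := uv (delta_mx 0 i).
  by rewrite /bform trmx_delta -!colE !mxE.
by rewrite /= -!mulmxA mulmxV // !mulmx1.
Qed.

Lemma endo_linear J p (a : R) (u v : tangent p) :
  endo J (a *: u + v) = a *: endo J u + endo J v.
Proof. by rewrite /endo mulmxDl scalemxAl. Qed.

Lemma endoZ J p (a : R) (u : tangent p) : endo J (a *: u) = a *: endo J u.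
Proof. by rewrite /endo scalemxAl. Qed.

Lemma endoB J p (u v : tangent p) : endo J (u - v) = endo J u - endo J v.
Proof. by rewrite /endo mulmxBl. Qed.

End Forms.

(** * Symmetries of the curvature of a metric connection *)

Section Curvature.
Context {R : realType} {n : nat} {M : smoothManifold R n}.
Context (D : connection M) (p : M).
Implicit Types (x y u v : tangent p) (Z W : vector_field (M := M)).

Lemma nabla_constant_extension_smooth Z x :
  smooth_field_near Z p ->
  smooth_field_near (fun q => D Z q (constant_extension x q)) p.
Proof. by move=> sZ; exact: nabla_smooth (constant_extension_smooth x) sZ. Qed.

Lemma curvature_field_constant Z x y : smooth_field_near Z p ->
  curvature_field D (constant_extension x) (constant_extension y) Z p
  = D (fun q => D Z q (constant_extension y q)) p x
    - D (fun q => D Z q (constant_extension x q)) p y.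
Proof.
move=> sZ.
rewrite /curvature_field lie_bracket_constant_extension (nabla0 D sZ).
by rewrite subr0 !constant_extension_at.
Qed.

Lemma curvatureE x y z : curvature D x y z
  = D (fun q => D (constant_extension z) q (constant_extension y q)) p x
    - D (fun q => D (constant_extension z) q (constant_extension x q)) p y.
Proof. exact/curvature_field_constant/constant_extension_smooth. Qed.

Lemma curvature_antisym x y z : curvature D x y z = - curvature D y x z.
Proof. by rewrite !curvatureE opprB. Qed.

(** The map v |-> [constant_extension v] is linear only near p, which suffices
    because D depends only on germs. *)
Lemma curvature_linear1 (a : R) u v y z :
  curvature D (a *: u + v) y z = a *: curvature D u y z + curvature D v y z.
Proof.
have sz := constant_extension_smooth z.
pose E (w : tangent p) q := D (constant_extension z) q (constant_extension w q).
have sE w : smooth_field_near (E w) p by exact: nabla_constant_extension_smooth.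
have cE w : curvature D w y z = D (E y) p w - D (E w) p y by exact: curvatureE.
have Elin : \forall q \near p, E (a *: u + v) q = a *: E u q + E v q.
  apply: filterS2 (constant_extension_linear a u v)
    (smooth_field_near_nbhs sz) => q e sq.
  by rewrite /E e; exact: nabla_linear sq _ _ _.
clearbody E; move: (@curvature _ _ _ D p) cE => C cE; rewrite !cE.
have sau := smooth_field_near_scale a (sE u).
rewrite (nabla_local D y Elin (sE _)) (nabla_add D y sau (sE v)).
rewrite (nablaZ D a y (sE u)) (nabla_linear D (sE y)).
by rewrite scalerBr opprD addrACA.
Qed.

Section Metric.
Variable g : M -> 'M[R]_n.
Hypotheses (rg : pseudo_riemannian g) (lc : levi_civita g D).

(** Both y(x(g(Z, W))) and x(y(g(Z, W))) are expanded by [metric_parallel].  The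
    cross terms g(D_x Z, D_y W) + g(D_y Z, D_x W) are the same in the two
    expansions, and what is left of their difference is the stated sum. *)
Lemma curvature_field_skew Z W x y :
  smooth_field_near Z p -> smooth_field_near W p ->
  bform g (curvature_field D (constant_extension x) (constant_extension y) Z p)
      (W p)
  + bform g (Z p)
      (curvature_field D (constant_extension x) (constant_extension y) W p) = 0.
Proof.
move=> sZ sW.
pose DZ (u : tangent p) q := D Z q (constant_extension u q).
pose DW (u : tangent p) q := D W q (constant_extension u q).
have second u v :
    dird (fun q =>
      dird (fun r => bform g (Z r) (W r)) (constant_extension u q)) v
    = bform g (D (DZ u) p v) (W p) + bform g (D Z p u) (D W p v)
      + (bform g (D Z p v) (D W p u) + bform g (Z p) (D (DW u) p v)).
  have sDZ : smooth_field_near (DZ u) p.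
    exact: nabla_constant_extension_smooth.
  have sDW : smooth_field_near (DW u) p.
    exact: nabla_constant_extension_smooth.
  have first : \forall q \near p,
      dird (fun r => bform g (Z r) (W r)) (constant_extension u q)
      = bform g (DZ u q) (W q) + bform g (Z q) (DW u q).
    apply: filterS2 (smooth_field_near_nbhs sZ) (smooth_field_near_nbhs sW).
    by move=> q sZq sWq; exact: (metric_parallel lc _ sZq sWq).
  rewrite (dird_near_eq v first) dird_add; try exact: (metric_smooth rg).
  rewrite (metric_parallel lc v sDZ sW) (metric_parallel lc v sZ sDW).
  have -> : DZ u p = D Z p u by rewrite /DZ constant_extension_at.
  by have -> : DW u p = D W p u by rewrite /DW constant_extension_at.
have sF := metric_smooth rg sZ sW.
have := dird_constant_extension_sym x y sF.
have -> : curvature_field D (constant_extension x) (constant_extension y) Z p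
    = D (DZ y) p x - D (DZ x) p y by exact: curvature_field_constant.
have -> : curvature_field D (constant_extension x) (constant_extension y) W p
    = D (DW y) p x - D (DW x) p y by exact: curvature_field_constant.
rewrite [LHS]second [RHS]second bformBl bformBr.
clearbody DZ DW => e; lra.
Qed.

(** Two fields with the same value at p have the same right-hand side
    - g(Z p, R(x, y)w) in [curvature_field_skew], for every w. *)
Lemma curvature_tensorial Z x y : smooth_field_near Z p ->
  curvature_field D (constant_extension x) (constant_extension y) Z p
  = curvature D x y (Z p).
Proof.
move=> sZ; apply: (bform_inj (metric_nondegenerate rg p)) => w.
have sw := constant_extension_smooth w.
have sz := constant_extension_smooth (Z p).
have eZ := curvature_field_skew x y sZ sw.
have ez := curvature_field_skew x y sz sw.
rewrite (constant_extension_at w) in eZ.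
rewrite (constant_extension_at (Z p)) (constant_extension_at w) in ez.
exact: addIr (etrans eZ (esym ez)).
Qed.

Lemma curvature_skew x y z w :
  bform g (curvature D x y z) w = - bform g z (curvature D x y w).
Proof.
have := curvature_field_skew x y (constant_extension_smooth z)
  (constant_extension_smooth w).
by rewrite !constant_extension_at => /eqP; rewrite addr_eq0 => /eqP.
Qed.

(** By skewness, g(R(x, y)z, w) = - g(z, R(x, y)w), which is linear in z. *)
Lemma curvature_linear3 (a : R) x y u v :
  curvature D x y (a *: u + v) = a *: curvature D x y u + curvature D x y v.
Proof.
apply: (bform_inj (metric_nondegenerate rg p)) => w.
have sk := curvature_skew x y; move: (curvature D x y) sk => C sk.
rewrite bform_linearl !sk bform_linearl; ring.
Qed.

End Metric.
End Curvature.

(** * The endomorphism J is parallel *)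

(** (D_v J) Y *)
Definition nabla_endo (R : realType) (n : nat) (M : smoothManifold R n)
    (D : connection M) (J : M -> 'M[R]_n) (p : M) (v : tangent p)
    (Y : vector_field) : tangent p :=
  D (endo_field J Y) p v - endo J (D Y p v).

Section Kahler.
Context {R : realType} {n : nat} {M : smoothManifold R n}.
Variables (g J Om : M -> 'M[R]_n) (D : connection M) (eps : R).
Hypotheses (eps0 : eps != 0) (hK : kahler_structure eps g J Om).
Hypothesis lc : levi_civita g D.
Implicit Types (p q : M) (W X Y Z : vector_field (M := M)).

Lemma bform_kahler p (u v : tangent p) : bform Om u v = bform g (endo J u) v.
Proof. by rewrite /bform /endo -(kahler_compatible hK) mulmxA. Qed.

Lemma metric_bform_sym p (u v : tangent p) : bform g u v = bform g v u.
Proof.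
by rewrite bform_tr /bform (Defs.metric_sym (kahler_metric hK)).
Qed.

Lemma bform_endo_skew p (u v : tangent p) :
  bform g (endo J u) v = - bform g u (endo J v).
Proof.
rewrite (metric_bform_sym u) -!bform_kahler [LHS]bform_tr /bform.
by rewrite (symplectic_antisym (kahler_symplectic hK)) mulmxN mulNmx mxE.
Qed.

Lemma endo_sqr p (u : tangent p) : endo J (endo J u) = eps *: u.
Proof. by rewrite /endo -mulmxA (kahler_endo_sqr hK) mul_mx_scalar. Qed.

Local Notation T v Y w := (bform g (nabla_endo D J v Y) w).
Local Notation E := (endo_field J).

Lemma endo_field_smooth X p :
  smooth_field_near X p -> smooth_field_near (E X) p.
Proof. exact: kahler_endo_smooth hK p X. Qed.

(** D_v J anticommutes with J because J^2 is a constant multiple of the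
    identity, and J is skew for g. *)
Lemma nabla_endo_endo Y p (v w : tangent p) :
  smooth_field_near Y p -> T v (E Y) w = T v Y (endo J w).
Proof.
move=> sY; rewrite -[RHS]opprK -bform_endo_skew /nabla_endo.
have -> : E (E Y) = (fun q => eps *: Y q).
  by apply: functional_extensionality_dep => q; exact: endo_sqr.
rewrite (nablaZ D eps v sY) endoB endo_sqr !bformBl; ring.
Qed.

(** The derivative of the identity g(JY, Z) + g(JZ, Y) = 0. *)
Lemma nabla_endo_skew Y Z p (v : tangent p) :
  smooth_field_near Y p -> smooth_field_near Z p ->
  T v Y (Z p) = - T v Z (Y p).
Proof.
move=> sY sZ.
have sJY := endo_field_smooth sY; have sJZ := endo_field_smooth sZ.
have sJYZ := metric_smooth (kahler_metric hK) sJY sZ.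
have sJZY := metric_smooth (kahler_metric hK) sJZ sY.
have : dird (fun q => bform g (E Y q) (Z q) + bform g (E Z q) (Y q)) v = 0.
  rewrite -(dird_cst (M:=M) 0 v); apply: dird_near_eq; near=> q.
  by rewrite (metric_bform_sym (E Z q)) bform_endo_skew addNr.
rewrite (dird_add v sJYZ sJZY) (metric_parallel lc v sJY sZ).
rewrite (metric_parallel lc v sJZ sY) !bformBl.
have := bform_endo_skew (Y p) (D Z p v).
have := bform_endo_skew (Z p) (D Y p v).
rewrite ![bform g _ (endo J (D _ p v))]metric_bform_sym /endo_field.
move=> e1 e2 e; lra.
Unshelve. all: by end_near. Qed.

(** For a torsion-free connection, d Om is the cyclic sum of D Om; and D Om is
    g((D J) . , .) since g is parallel. *)
Lemma nabla_endo_cyclic X Y Z p :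
  smooth_field_near X p -> smooth_field_near Y p -> smooth_field_near Z p ->
  T (X p) Y (Z p) + T (Y p) Z (X p) + T (Z p) X (Y p) = 0.
Proof.
move=> sX sY sZ.
have dOm U V (v : tangent p) : smooth_field_near U p -> smooth_field_near V p ->
    dird (fun q => bform Om (U q) (V q)) v
    = bform g (D (E U) p v) (V p) - bform g (endo J (D V p v)) (U p).
  move=> sU sV.
  have -> : (fun q => bform Om (U q) (V q)) = (fun q => bform g (E U q) (V q)).
    by apply: functional_extensionality_dep => q; exact: bform_kahler.
  rewrite (metric_parallel lc v (endo_field_smooth sU) sV).
  by congr (_ + _); rewrite bform_endo_skew opprK metric_bform_sym.
have := symplectic_closed (kahler_symplectic hK) sX sY sZ.
rewrite (dOm _ _ _ sY sZ) (dOm _ _ _ sZ sX) (dOm _ _ _ sX sY).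
rewrite -(torsion_free lc sX sY) -(torsion_free lc sY sZ).
rewrite -(torsion_free lc sZ sX).
rewrite !bform_kahler !endoB !bformBl => e; lra.
Qed.

(** With brackets written as [X, Y] = D_X Y - D_Y X, the Nijenhuis tensor is
    (D_JX J)Y - (D_JY J)X + J (D_Y J)X - J (D_X J)Y. *)
Lemma nabla_endo_nijenhuis X Y p (w : tangent p) :
  smooth_field_near X p -> smooth_field_near Y p ->
  T (E X p) Y w + T (X p) Y (endo J w) = T (E Y p) X w + T (Y p) X (endo J w).
Proof.
move=> sX sY.
have sJX := endo_field_smooth sX; have sJY := endo_field_smooth sY.
have := kahler_endo_integrable hK sX sY.
rewrite -(torsion_free lc sJX sJY) -(torsion_free lc sJX sY).
rewrite -(torsion_free lc sX sJY) -(torsion_free lc sX sY).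
move=> /(congr1 (fun u => bform g u w)).
rewrite bform0l /nabla_endo !endoB bformDl !bformBl !bform_endo_skew => e; lra.
Qed.

(** In the proof, [skew] and [nabla_endo_nijenhuis] are the two symmetries of
    A(X, Y, Z) = T(JX, Y, Z) + T(X, Y, JZ), which force [A0]; adding the cyclic
    identities for (JX, Y, Z) and (X, JY, Z) then leaves 2 T(Z, X, JY) = 0. *)
Lemma nabla_endo0 W p (v : tangent p) : smooth_field_near W p ->
  nabla_endo D J v W = 0.
Proof.
have skew X Y Z : smooth_field_near X p -> smooth_field_near Y p ->
    smooth_field_near Z p ->
    T (E X p) Y (Z p) + T (X p) Y (E Z p)
    = - (T (E X p) Z (Y p) + T (X p) Z (E Y p)).
  move=> sX sY sZ; have sJY := endo_field_smooth sY.
  rewrite (nabla_endo_skew (E X p) sY sZ) -(nabla_endo_endo _ _ sY).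
  by rewrite (nabla_endo_skew (X p) sJY sZ) -opprD.
have A0 X Y Z : smooth_field_near X p -> smooth_field_near Y p ->
    smooth_field_near Z p -> T (E X p) Y (Z p) + T (X p) Y (E Z p) = 0.
  move=> sX sY sZ.
  have e1 := nabla_endo_nijenhuis (Z p) sX sY.
  have e2 := skew _ _ _ sY sX sZ.
  have e3 := nabla_endo_nijenhuis (X p) sY sZ.
  have e4 := skew _ _ _ sZ sY sX.
  have e5 := nabla_endo_nijenhuis (Y p) sZ sX.
  have e6 := skew _ _ _ sX sZ sY.
  rewrite /endo_field in e1 e2 e3 e4 e5 e6 *; lra.
have T0 X Y Z : smooth_field_near X p -> smooth_field_near Y p ->
    smooth_field_near Z p -> T (Z p) X (E Y p) = 0.
  move=> sX sY sZ.
  have sJX := endo_field_smooth sX; have sJY := endo_field_smooth sY.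
  have e1 := nabla_endo_cyclic sJX sY sZ.
  have e2 := nabla_endo_cyclic sX sJY sZ.
  have e3 := A0 _ _ _ sX sY sZ.
  have e4 := A0 _ _ _ sY sZ sX.
  have e5 := nabla_endo_endo (Z p) (Y p) sX.
  have e6 := nabla_endo_endo (X p) (Z p) sY.
  rewrite /endo_field in e1 e2 e3 e4 e5 e6 *; lra.
move=> sW; apply: (bform_inj (metric_nondegenerate (kahler_metric hK) p)) => w.
rewrite bform0l.
(* every w is J y, with y = eps^-1 J w *)
have := T0 W _ _ sW (constant_extension_smooth (eps^-1 *: endo J w))
  (constant_extension_smooth v).
rewrite /endo_field !constant_extension_at.
have -> // : endo J (eps^-1 *: endo J w) = w.
by rewrite endoZ endo_sqr scalerA mulVf // scale1r.
Qed.

(** J commutes with D on fields, hence with both second derivatives.  The field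
    J Z, for Z the coordinate field of z, is not the coordinate field of J z;
    [curvature_tensorial] identifies their curvatures. *)
Lemma curvature_endo p (x y z : tangent p) :
  curvature D x y (endo J z) = endo J (curvature D x y z).
Proof.
have sz := constant_extension_smooth z; have sJz := endo_field_smooth sz.
have DJ q Z (v : tangent q) : smooth_field_near Z q ->
    D (E Z) q v = endo J (D Z q v).
  by move=> sZ; apply/eqP; rewrite -subr_eq0; apply/eqP; exact: nabla_endo0.
have DDJ (u v : tangent p) :
    D (fun q => D (E (constant_extension z)) q (constant_extension u q)) p v
    = endo J
        (D (fun q => D (constant_extension z) q (constant_extension u q)) p v).
  have sD := nabla_constant_extension_smooth D u sz.
  rewrite -DJ //; apply: nabla_local.
    by apply: filterS (smooth_field_near_nbhs sz) => q; exact: DJ.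
  exact: nabla_constant_extension_smooth.
rewrite -{1}(constant_extension_at z).
rewrite -(curvature_tensorial (kahler_metric hK) lc x y sJz).
apply: etrans (curvature_field_constant D x y sJz) _.
apply: etrans (congr2 (fun u v => u - v) (DDJ y x) (DDJ x y)) _.
by rewrite -endoB curvatureE.
Qed.

End Kahler.

(** * Bases of planes *)

Section Planes.
Context {R : realType} {U : vectType R}.

Lemma mem_span2 (u v y : U) :
  y \in <<[:: u; v]>>%VS -> exists a b, y = a *: u + b *: v.
Proof.
rewrite span_cons span_seq1 => /memv_addP[_ /vlineP[a ->] [_ /vlineP[b ->] ->]].
by exists a, b.
Qed.

(** The dimension of L is at most 2, so that [vbasis L] has no further
    entries; if it is smaller, the missing entries are read as 0, which lies in
    L as well. *)
Lemma plane_vbasis (u v : U) (L : {vspace U}) : L = <<[:: u; v]>>%VS ->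
  L = <<[:: (vbasis L)`_0; (vbasis L)`_1]>>%VS.
Proof.
move=> LE; apply/eqP; rewrite eqEsubv -{1}(span_basis (vbasisP L)).
apply/andP; split; apply/span_subvP => w.
  have dimL : (\dim L <= 2)%N by rewrite LE; exact: (dim_span [:: u; v]).
  move=> /(nthP 0)[i]; rewrite size_tuple => /leq_trans/(_ dimL) i2 <-.
  by apply: memv_span; case: i i2 => [|[|//]] _; rewrite !inE eqxx ?orbT.
have inL i : (vbasis L)`_i \in L.
  have [ile|igt] := ltnP i (size (vbasis L)).
    by apply: vbasis_mem; exact: mem_nth.
  by rewrite nth_default // mem0v.
by rewrite !inE => /orP[] /eqP ->; exact: inL.
Qed.

Lemma alternating_plane (V : lmodType R) (f : U -> U -> V) (u v : U)
    (a b c d : R) :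
  (forall (k : R) x y z, f (k *: x + y) z = k *: f x z + f y z) ->
  (forall x y, f x y = - f y x) ->
  f (a *: u + b *: v) (c *: u + d *: v) = (a * d - b * c) *: f u v.
Proof.
move=> flin fanti.
have f0 z : f 0 z = 0.
  by have := flin (-1) 0 0 z; rewrite scaler0 addr0 scaleN1r addNr.
have fZ k x z : f (k *: x) z = k *: f x z.
  by rewrite -[k *: x]addr0 flin f0 addr0.
have fxx x : f x x = 0.
  apply/eqP; have : f x x *+ 2 == 0 by rewrite mulr2n {1}fanti addNr.
  by rewrite -scaler_nat scaler_eq0 pnatr_eq0.
have half x : f x (c *: u + d *: v) = c *: f x u + d *: f x v.
  by rewrite fanti flin fZ opprD -!scalerN -!fanti.
rewrite flin fZ !half // !fxx !scaler0 add0r addr0 (fanti v u).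
by rewrite !scalerN !scalerA -scaleNr -scalerDl mulrC (mulrC b).
Qed.

End Planes.

(** * The plane spanned by X and JX *)

Section HolomorphicPlane.
Context {R : realType} {n : nat} {M : smoothManifold R n}.
Variables (g J Om : M -> 'M[R]_n) (D : connection M) (eps : R).
Hypotheses (eps0 : eps != 0) (hK : kahler_structure eps g J Om).
Hypothesis lc : levi_civita g D.

(** The basis A, B of L that defines the symplectic curvature is expressed in
    X, JX by a matrix of determinant delta, and delta cancels.  That delta is
    nonzero follows from Om(X, JX) != 0, as X and JX are in turn combinations of
    A and B. *)
Lemma symplectic_curvature_holomorphic_plane (p : M) (X Y : tangent p)
    (L : {vspace tangent p}) :
  bform g X X != 0 -> L = <<[:: X; endo J X]>>%VS -> Y \in L ->
  symplectic_curvature Om D L Y = bform g Y Y * holomorphic_curvature g J D X.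
Proof.
move=> m0 LE; rewrite LE => /mem_span2[a [b YE]].
pose JX := endo J X.
have skewJ (u v : tangent p) : bform g (endo J u) v = - bform g u (endo J v).
  exact: (bform_endo_skew hK).
have gsym (u v : tangent p) : bform g u v = bform g v u.
  exact: (metric_bform_sym hK).
have gXJX : bform g X JX = 0.
  by have := skewJ X X; rewrite gsym -/JX => e; lra.
have gJXJX : bform g JX JX = - eps * bform g X X.
  rewrite /JX skewJ (endo_sqr hK) gsym bformZl mulNr; ring.
have OmE : forall u v : tangent p, bform Om u v = bform g (endo J u) v.
  exact: (bform_kahler hK).
have Om_anti (u v : tangent p) : bform Om u v = - bform Om v u.
  by rewrite !OmE skewJ gsym.
have OmXJX : bform Om X JX = - eps * bform g X X by rewrite OmE.
have OmXJX0 : bform Om X JX != 0 by rewrite OmXJX mulf_neq0 // oppr_eq0.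
have LV := plane_vbasis LE; rewrite /symplectic_curvature -LE.
move: (vbasis L)`_0 (vbasis L)`_1 LV => A B LV.
have [XAB JXAB] : X \in <<[:: A; B]>>%VS /\ JX \in <<[:: A; B]>>%VS.
  by rewrite -LV LE; split; apply: memv_span; rewrite !inE eqxx ?orbT.
have [AXJX BXJX] : A \in <<[:: X; JX]>>%VS /\ B \in <<[:: X; JX]>>%VS.
  by rewrite -LE LV; split; apply: memv_span; rewrite !inE eqxx ?orbT.
have [e [f XE]] := mem_span2 XAB; have [h [k JXE]] := mem_span2 JXAB.
have [a1 [b1 AE]] := mem_span2 AXJX; have [c1 [d1 BE]] := mem_span2 BXJX.
have Om_plane (u v : tangent p) (s t s' t' : R) :
    bform Om (s *: u + t *: v) (s' *: u + t' *: v)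
    = (s * t' - t * s') * bform Om u v.
  apply: (@alternating_plane _ _ R^o (fun u v => bform Om u v)).
    by move=> k' x y z; exact: bform_linearl.
  exact: Om_anti.
set delta := a1 * d1 - b1 * c1.
have OmAB : bform Om A B = delta * bform Om X JX by rewrite AE BE Om_plane.
have delta0 : delta != 0.
  apply: contraNneq OmXJX0 => delta0.
  by rewrite {1}XE {1}JXE Om_plane OmAB delta0 mul0r mulr0.
have RAB z : curvature D A B z = delta *: curvature D X JX z.
  rewrite AE BE; apply: (alternating_plane (f := fun u v => curvature D u v z)).
    by move=> k' x y w; exact: curvature_linear1.
  by move=> x y; exact: curvature_antisym.
rewrite RAB bformZl OmAB -mulf_div divff // mul1r.
rewrite /holomorphic_curvature -/JX (curvature_antisym D JX) bformNl.
have Rlin := curvature_linear3 (kahler_metric hK) lc _ X JX.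
have Rskew := curvature_skew (kahler_metric hK) lc X JX.
have RJ := curvature_endo eps0 hK lc X JX.
move: (curvature D X JX) Rlin Rskew RJ => C Clin Cskew CJ.
have gCXX : bform g (C X) X = 0 by have := Cskew X X; rewrite gsym => e'; lra.
have C0 : C 0 = 0.
  by have := Clin (-1) 0 0; rewrite scaler0 addr0 scaleN1r addNr.
have CZ t u : C (t *: u) = t *: C u by rewrite -[t *: u]addr0 Clin C0 addr0.
have gJCXX : bform g (endo J (C X)) X = - bform g (C X) JX by rewrite skewJ.
have gJCXJX : bform g (endo J (C X)) JX = 0.
  by rewrite skewJ (endo_sqr hK) bformZr gCXX mulr0 oppr0.
have -> : bform Om (C Y) Y = (eps * b ^+ 2 - a ^+ 2) * bform g (C X) JX.
  rewrite YE Clin CZ (CJ X) OmE endo_linear endoZ (endo_sqr hK).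
  rewrite bform_linearl !bformZl !bform_linearr !bformZr gJCXX gJCXJX gCXX.
  ring.
have -> : bform g Y Y = (a ^+ 2 - eps * b ^+ 2) * bform g X X.
  rewrite YE bform_linearl !bform_linearr !bformZl !bformZr.
  rewrite gXJX (gsym _ X) gXJX gJXJX; ring.
rewrite OmXJX gXJX gJXJX; field.
by rewrite m0 eps0.
Qed.

End HolomorphicPlane.

Theorem lemma4p1 (R : realType) (n : nat) (M : smoothManifold R n)
    (g J Om : M -> 'M[R]_n) (D : connection M)
    (hK : pseudo_kahler g J Om \/ para_kahler g J Om)
    (hD : levi_civita g D)
    (p : M) (X : tangent p) (hX : bform g X X != 0)
    (L : {vspace tangent p}) (hL : L = <<[:: X; endo J X]>>%VS) :
  forall Y : tangent p, Y \in L ->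
    symplectic_curvature Om D L Y
    = bform g Y Y * holomorphic_curvature g J D X.
Proof.
move=> Y YL; case: hK => [hJ|[hJ _]].
- have N1 : (- 1 : R) != 0 by rewrite oppr_eq0 oner_eq0.
  exact: (symplectic_curvature_holomorphic_plane N1 hJ).
- exact: (symplectic_curvature_holomorphic_plane (oner_neq0 R) hJ).
Qed.
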